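(* A morphism $\phi$ from a groupoid $\Gamma$ to a groupoid $\Delta$ is a monomorphism (in the category of groupoids with Zakrzewski morphisms) if and only if $\ker(\phi)=\Gamma^{(0)}$.
   Context: A relation $r$ from a set $X$ to a set $Y$ is given by its graph, a subset of $Y\times X$; we write $(y,x)\in r$. Its domain is $D(r)=\{x:\exists y,\ (y,x)\in r\}$, and $r(A)=\{y:\exists x\in A,\ (y,x)\in r\}$ for $A\subset X$. Relations are composed by $(z,x)\in tr\iff\exists y:\ (z,y)\in t,\ (y,x)\in r$, and $r\times r_1=\{(y,y_1;x,x_1):(y,x)\in r,\ (y_1,x_1)\in r_1\}$. A groupoid $\Gamma\rightrightarrows E$ is a small category with all morphisms invertible; $\Gamma$ is the set of morphisms and $E=\Gamma^{(0)}\subset\Gamma$ the set of identities. $s(\gamma)$ is the inverse of $\gamma$, $e_R(\gamma)=s(\gamma)\gamma$ is its source, $e_L(\gamma)=\gamma s(\gamma)$ its target; $\gamma_1\gamma_2$ is defined iff $e_R(\gamma_1)=e_L(\gamma_2)$. The multiplication is the relation $m$ from $\Gamma\times\Gamma$ to $\Gamma$ with $(\gamma;\gamma_1,\gamma_2)\in m$ iff $\gamma_1\gamma_2$ is defined and equals $\gamma$. A (Zakrzewski) morphism from $\Gamma\rightrightarrows E$ to $\Gamma_1\rightrightarrows E_1$ is a relation $h$ from $\Gamma$ to $\Gamma_1$ such that $hm=m_1(h\times h)$, $hs=s_1h$ and $h(E)=E_1$ (here $m_1,s_1$ are the structure relations of $\Gamma_1$). Groupoids with these morphisms form a category under composition of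 relations. The kernel of a morphism $h$ from $\Gamma$ to $\Delta$ is $\ker(h)=\{\gamma\in D(h): (\delta,\gamma)\in h\Rightarrow\delta\in\Delta^{(0)}\}$ (i.e. every $\delta$ with $(\delta,\gamma)\in h$ is an identity). *)

(* Defs.v *)
From mathcomp Require Import all_boot.
From mathcomp Require Import boolp classical_sets.

Set Implicit Arguments.
Unset Strict Implicit.
Unset Printing Implicit Defensive.

Local Open Scope classical_set_scope.

(* A relation from X to Y is a set (Y * X): the target component comes first. *)

Definition rel_dom (X Y : Type) (r : set (Y * X)) : set X :=
  [set x | exists y, r (y, x)].

Definition rel_image (X Y : Type) (r : set (Y * X)) (A : set X) : set Y :=
  [set y | exists2 x, A x & r (y, x)].

(* "t after r", i.e. [set zx | exists2 y, t (zx.1, y) & r (y, zx.2)]; the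
   library notation \; lists the factors in the opposite order. *)
Definition rel_comp (X Y Z : Type) (t : set (Z * Y)) (r : set (Y * X)) :
  set (Z * X) := (r \; t)%relation.

Definition rel_prod (X Y X1 Y1 : Type) (r : set (Y * X)) (r1 : set (Y1 * X1)) :
  set ((Y * Y1) * (X * X1)) :=
  [set p | r (p.1.1, p.2.1) /\ r1 (p.1.2, p.2.2)].

Definition rel_of_fun (X Y : Type) (f : X -> Y) : set (Y * X) :=
  [set p | p.1 = f p.2].

(* A small category with all morphisms invertible, presented by its set of
   morphisms (possibly empty).  gmul a b is the product "a after b"; None means
   that it is not defined. *)
Record groupoid : Type := Groupoid {
  arrow :> Type;
  gunit : set arrow;
  gsrc : arrow -> arrow;
  gtgt : arrow -> arrow;
  gmul : arrow -> arrow -> option arrow;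
  ginv : arrow -> arrow;
  gsrc_unit : forall a, gunit (gsrc a);
  gtgt_unit : forall a, gunit (gtgt a);
  gunit_src : forall e, gunit e -> gsrc e = e;
  gunit_tgt : forall e, gunit e -> gtgt e = e;
  gmul_def : forall a b, (exists c, gmul a b = Some c) <-> gsrc a = gtgt b;
  gsrc_mul : forall a b c, gmul a b = Some c -> gsrc c = gsrc b;
  gtgt_mul : forall a b c, gmul a b = Some c -> gtgt c = gtgt a;
  gmulA : forall a b c ab bc, gmul a b = Some ab -> gmul b c = Some bc ->
    gmul ab c = gmul a bc;
  gmul_src : forall a, gmul a (gsrc a) = Some a;
  gmul_tgt : forall a, gmul (gtgt a) a = Some a;
  gmul_invl : forall a, gmul (ginv a) a = Some (gsrc a);
  gmul_invr : forall a, gmul a (ginv a) = Some (gtgt a)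
}.

Definition mult_rel (G : groupoid) : set (G * (G * G)) :=
  [set p | gmul p.2.1 p.2.2 = Some p.1].

Definition inv_rel (G : groupoid) : set (G * G) := rel_of_fun (@ginv G).

Definition zakrzewski_morphism (G G1 : groupoid) (h : set (G1 * G)) : Prop :=
  [/\ rel_comp h (@mult_rel G) = rel_comp (@mult_rel G1) (rel_prod h h),
      rel_comp h (@inv_rel G) = rel_comp (@inv_rel G1) h
    & rel_image h (@gunit G) = @gunit G1].

Definition ker_rel (G D : groupoid) (h : set (D * G)) : set G :=
  [set g | rel_dom h g /\ forall d, h (d, g) -> @gunit D d].

Definition zakrzewski_mono (G D : groupoid) (phi : set (D * G)) : Prop :=
  forall (L : groupoid) (h k : set (G * L)),
    zakrzewski_morphism h -> zakrzewski_morphism k ->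
    rel_comp phi h = rel_comp phi k -> h = k.

(* Main.v *)
Require Import Defs.
From mathcomp Require Import all_boot.
From mathcomp Require Import boolp classical_sets.

(** A morphism [phi] from [Gamma] to [Delta] lets [Gamma] act on the units of
    [Delta]: each unit [u] of [Delta] lies over exactly one unit of [Gamma],
    and an arrow [a] of [Gamma] whose source lies under [u] has exactly one
    lift, an arrow [d] with [phi (d, a)] and source [u] ([exists_lift],
    [lift_unique]).  An arrow of the domain is in the kernel when all its lifts
    are units.

    Suppose that the kernel is the set of units.  Then every unit of [Gamma],
    and hence every arrow, has a lift.  If [phi] composed with [h] equals [phi]
    composed with [k], take [h (g, l)].  The lifts of [g] show that [l] is also
    [k]-related to an arrow [g'] with the same source as [g], and that [g] and
    [g'] have the same lifts.  So every lift of [g * g'^-1] is a unit,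
    [g * g'^-1] lies in the kernel, and [g = g'] ([mono_of_ker]).

    Conversely, let [phi] be a monomorphism.  Every map from the units of
    [Gamma] to a set [T] is a morphism to [Gamma] from [T] regarded as a
    groupoid of units only; composing with [phi] forgets its values at the
    units outside the domain of [phi], so there are none ([mono_unit_dom]).
    The kernel is then a bundle of groups over all the units of [Gamma].  Both
    the inclusion of the kernel and the map sending each of its arrows to its
    source are morphisms, and [phi] does not distinguish them; so each arrow of
    the kernel is its own source, that is, a unit. *)

Set Implicit Arguments.
Unset Strict Implicit.
Unset Printing Implicit Defensive.

Local Open Scope classical_set_scope.

(** * Elementary groupoid identities *)

Section GroupoidTheory.
Variable G : groupoid.
Implicit Types a b c e : G.

Lemma src_inv a : gsrc (ginv a) = gtgt a.
Proof. by rewrite -(gsrc_mul (gmul_invr a)) gunit_src //; exact: gtgt_unit. Qed.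

Lemma tgt_inv a : gtgt (ginv a) = gsrc a.
Proof. by rewrite -(gtgt_mul (gmul_invl a)) gunit_tgt //; exact: gsrc_unit. Qed.

Lemma mul_composable a b c : gmul a b = Some c -> gsrc a = gtgt b.
Proof. by move=> abc; apply/gmul_def; exists c. Qed.

Lemma unit_mul e : gunit e -> gmul e e = Some e.
Proof. by move=> ue; rewrite -{2}(gunit_src ue) gmul_src. Qed.

Lemma composable_units e e' c : gunit e -> gunit e' -> gmul e e' = Some c ->
  e = e'.
Proof.
by move=> ue ue' /mul_composable; rewrite gunit_src // gunit_tgt.
Qed.

Lemma units_mul e e' c : gunit e -> gunit e' -> gmul e e' = Some c -> c = e.
Proof.
move=> ue ue' eqc; move: (eqc); rewrite -(composable_units ue ue' eqc).
by rewrite unit_mul // => -[].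
Qed.

(** If [a b^-1] is a unit [e], then [e b = a b^-1 b = a], while [e b = b]. *)
Lemma mul_inv_unit_eq a b e : gmul a (ginv b) = Some e -> gunit e -> a = b.
Proof.
move=> abe ue; have := gmulA abe (gmul_invl b).
rewrite -tgt_inv -(mul_composable abe) gmul_src => eba.
move: (eba); rewrite -(gunit_src ue) (mul_composable eba) gmul_tgt.
by case.
Qed.

Lemma invK a : ginv (ginv a) = a.
Proof. exact: mul_inv_unit_eq (gmul_invl _) (gsrc_unit _). Qed.

Lemma inv_unit e : gunit e -> ginv e = e.
Proof.
move=> ue; apply/esym; apply: (@mul_inv_unit_eq _ _ e) => //.
by rewrite invK unit_mul.
Qed.

End GroupoidTheory.

(** * Lifting along a morphism *)

Lemma zakrzewski_morphismP (G G1 : groupoid) (h : set (G1 * G)) :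
  zakrzewski_morphism h <->
  [/\ forall x a b, (exists2 c, gmul a b = Some c & h (x, c)) <->
        (exists x1 x2, [/\ h (x1, a), h (x2, b) & gmul x1 x2 = Some x]),
      forall x a, h (x, ginv a) <-> h (ginv x, a)
    & forall x, (exists2 e, gunit e & h (x, e)) <-> gunit x].
Proof.
split=> -[hM hV h1]; split.
- move=> x a b.
  have {hM} := congr1 (fun r : set _ => r (x, (a, b))) hM.
  rewrite /rel_comp /mult_rel /rel_prod /= => hM; split.
    move=> [c abc hxc]; have : exists2 c, h (x, c) & gmul a b = Some c.
      by exists c.
    by rewrite hM => -[[x1 x2] /= x12 [hx1 hx2]]; exists x1, x2.
  move=> [x1 [x2 [hx1 hx2 x12]]].
  suff : exists2 c, h (x, c) & gmul a b = Some c by move=> [c ? ?]; exists c.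
  by rewrite hM; exists (x1, x2).
- move=> x a; have {hV} := congr1 (fun r : set _ => r (x, a)) hV.
  rewrite /rel_comp /inv_rel /rel_of_fun /= => hV; split=> hx.
    have : exists2 z, h (x, z) & z = ginv a by exists (ginv a).
    by rewrite hV => -[y ->]; rewrite invK.
  suff : exists2 z, h (x, z) & z = ginv a by move=> [z ? <-].
  by rewrite hV; exists (ginv x); rewrite ?invK.
- by move=> x; rewrite -h1.
- apply/predeqP => -[x [a b]]; rewrite /rel_comp /mult_rel /rel_prod /=.
  split=> [[c hx abc]|[[x1 x2] /= x12 [hx1 hx2]]].
    have /hM[x1 [x2 [? ? ?]]] : exists2 c, gmul a b = Some c & h (x, c).
      by exists c.
    by exists (x1, x2).
  suff /hM[c ? ?] :
      exists x1 x2, [/\ h (x1, a), h (x2, b) & gmul x1 x2 = Some x].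
    by exists c.
  by exists x1, x2.
- apply/predeqP => -[x a]; rewrite /rel_comp /inv_rel /rel_of_fun /=; split.
    by move=> [_ /[swap] -> /hV hx]; exists (ginv x); rewrite ?invK.
  by move=> [y -> hy]; exists (ginv a) => //; apply/hV; rewrite invK.
- by apply/predeqP => x; exact: h1.
Qed.

Section MorphismTheory.
Variables (G G1 : groupoid) (h : set (G1 * G)).
Hypothesis h_morph : zakrzewski_morphism h.
Implicit Types (a b c e : G) (x y u : G1).

Lemma morph_mul_inv x a b c : h (x, c) -> gmul a b = Some c ->
  exists x1 x2, [/\ h (x1, a), h (x2, b) & gmul x1 x2 = Some x].
Proof.
by have /zakrzewski_morphismP[hM _ _] := h_morph; move=> *; apply/hM; exists c.
Qed.

Lemma morph_mul x1 x2 x a b : h (x1, a) -> h (x2, b) -> gmul x1 x2 = Some x ->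
  exists2 c, gmul a b = Some c & h (x, c).
Proof.
have /zakrzewski_morphismP[hM _ _] := h_morph; move=> *.
by apply/hM; exists x1, x2.
Qed.

Lemma morph_inv x a : h (x, a) -> h (ginv x, ginv a).
Proof.
have /zakrzewski_morphismP[_ hV _] := h_morph => hx.
by apply/hV; rewrite invK.
Qed.

Lemma morph_unit x e : gunit e -> h (x, e) -> gunit x.
Proof.
by have /zakrzewski_morphismP[_ _ h1] := h_morph; move=> *; apply/h1; exists e.
Qed.

Lemma morph_src x a : h (x, a) -> h (gsrc x, gsrc a).
Proof.
move=> hx; have [c] := morph_mul (morph_inv hx) hx (gmul_invl x).
by rewrite gmul_invl => -[->].
Qed.

Lemma morph_tgt x a : h (x, a) -> h (gtgt x, gtgt a).
Proof.
move=> hx; have [c] := morph_mul hx (morph_inv hx) (gmul_invr x).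
by rewrite gmul_invr => -[->].
Qed.

(** A unit is composable with itself, hence so are any two units below it. *)
Lemma base_unique u e e' : gunit e -> gunit e' -> h (u, e) -> h (u, e') ->
  e = e'.
Proof.
move=> ue ue' he he'; have uu := morph_unit ue he.
have [c eqc _] := morph_mul he he' (unit_mul uu).
exact: composable_units ue ue' eqc.
Qed.

(** The right factor of a decomposition of the unit over [gsrc a], along
    [a^-1 a = gsrc a], is a lift of [a]. *)
Lemma exists_lift u a : h (u, gsrc a) -> exists2 x, h (x, a) & gsrc x = u.
Proof.
move=> hu; have [x1 [x [_ hx x12]]] := morph_mul_inv hu (gmul_invl a).
exists x => //; rewrite -(gsrc_mul x12) gunit_src //.
exact: morph_unit (gsrc_unit a) hu.
Qed.

(** The product [x y^-1] is related to the unit [a a^-1], so it is a unit. *)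
Lemma lift_unique x y a : h (x, a) -> h (y, a) -> gsrc x = gsrc y -> x = y.
Proof.
move=> hx hy; rewrite -(tgt_inv y) => /gmul_def[z xyz].
have [c ] := morph_mul hx (morph_inv hy) xyz.
rewrite gmul_invr => -[<-] hz.
exact: mul_inv_unit_eq xyz (morph_unit (gtgt_unit a) hz).
Qed.

Lemma unit_sub_ker : @gunit G `<=` rel_dom h -> @gunit G `<=` ker_rel h.
Proof. by move=> D e ue; split=> [|d /(morph_unit ue)] //; exact: D. Qed.

Lemma total_of_unit_dom : @gunit G `<=` rel_dom h -> forall a, rel_dom h a.
Proof.
move=> D a; have [u /exists_lift[x hx _]] := D _ (gsrc_unit a).
by exists x.
Qed.

(** Source and target of a kernel arrow lie under the same unit, namely any of
    its lifts. *)
Lemma ker_src_tgt a : ker_rel h a -> gsrc a = gtgt a.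
Proof.
case=> -[u hu] /(_ _ hu) uu; have := morph_tgt hu; have := morph_src hu.
rewrite gunit_src // gunit_tgt // => hs ht.
exact: base_unique (gsrc_unit a) (gtgt_unit a) hs ht.
Qed.

Lemma ker_inv a : ker_rel h a -> ker_rel h (ginv a).
Proof.
case=> -[x hx] K; split; first by exists (ginv x); exact: morph_inv.
move=> d /morph_inv; rewrite invK => /K ud.
by rewrite -(invK d) inv_unit.
Qed.

(** A lift of [a b] factors as a lift of [a] times a lift of [b]; both factors
    are units. *)
Lemma ker_mul a b c : gmul a b = Some c -> ker_rel h a -> ker_rel h b ->
  ker_rel h c.
Proof.
move=> abc aK [[x hx] Kb]; split.
  have : h (x, gsrc c).
    rewrite (gsrc_mul abc) -(gunit_src (Kb _ hx)).
    exact: morph_src.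
  by case/exists_lift=> y hy _; exists y.
move=> d hd; have [d1 [d2 [hd1 hd2 d12]]] := morph_mul_inv hd abc.
have ud1 : gunit d1 by case: aK => _; apply.
by rewrite (units_mul ud1 (Kb _ hd2) d12).
Qed.

End MorphismTheory.

(** * Trivial kernel implies monomorphism *)

Section MonoOfKer.
Variables (L G D : groupoid) (phi : set (D * G)) (h k : set (G * L)).
Hypothesis phi_morph : zakrzewski_morphism phi.
Hypothesis k_morph : zakrzewski_morphism k.
Hypothesis phi_ker : ker_rel phi = @gunit G.
Hypothesis phi_hk : rel_comp phi h = rel_comp phi k.

Let unit_dom : @gunit G `<=` rel_dom phi.
Proof. by rewrite -phi_ker => e []. Qed.

Lemma transfer d g l : phi (d, g) -> h (g, l) ->
  exists2 g', phi (d, g') & k (g', l).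
Proof.
move=> pg hg; have : rel_comp phi h (d, l) by exists g.
by rewrite phi_hk.
Qed.

(** The unit below the source of [d] is unique, so any two arrows with a common
    lift have the same source. *)
Lemma src_eq_of_lift d g g' : phi (d, g) -> phi (d, g') -> gsrc g = gsrc g'.
Proof.
move=> /(morph_src phi_morph) pg /(morph_src phi_morph) pg'.
exact (base_unique phi_morph (gsrc_unit g) (gsrc_unit g') pg pg').
Qed.

(** Two arrows with the same source and the same lifts differ by an arrow of the
    kernel.  Uniqueness of lifts along [k] makes the arrow [g'] found from one
    lift of [g] serve all the lifts of [g]. *)
Lemma sub_of_ker : h `<=` k.
Proof.
move=> [g l] hg.
have [d pg] := total_of_unit_dom phi_morph unit_dom g.
have [g' pg' kg'] := transfer pg hg.
have sg := src_eq_of_lift pg pg'.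
(* Every lift of g, not only d, is a lift of the same g'. *)
have lift_g' x : phi (x, g) -> phi (x, g').
  move=> px; have [g'' pg'' kg''] := transfer px hg.
  suff -> : g' = g'' by [].
  apply: (lift_unique k_morph kg' kg'').
  by rewrite -sg (src_eq_of_lift px pg'').
have [c gc] : exists c, gmul g (ginv g') = Some c.
  by apply/gmul_def; rewrite tgt_inv.
suff uc : gunit c by rewrite (mul_inv_unit_eq gc uc).
rewrite -phi_ker; split; first exact: total_of_unit_dom.
move=> x px; have [x1 [x2 [px1 px2 x12]]] := morph_mul_inv phi_morph px gc.
have px2V : phi (ginv x2, g') by rewrite -(invK g'); exact: morph_inv.
have x1E : x1 = ginv x2.
  apply: (lift_unique phi_morph (lift_g' _ px1) px2V).
  by rewrite src_inv (mul_composable x12).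
move: x12; rewrite x1E gmul_invl => -[<-]; exact: gsrc_unit.
Qed.

End MonoOfKer.

Lemma mono_of_ker (G D : groupoid) (phi : set (D * G)) :
  zakrzewski_morphism phi -> ker_rel phi = @gunit G -> zakrzewski_mono phi.
Proof.
move=> mphi K L h k mh mk hk; apply/seteqP; split.
  exact: (sub_of_ker mphi mk K hk).
exact: (sub_of_ker mphi mh K (esym hk)).
Qed.

(** * Monomorphisms have full domain *)

Section Discrete.
Variable T : eqType.

Let dmul (a b : T) := if a == b then Some a else None.

Let dmulE a b c : dmul a b = Some c <-> a = b /\ c = a.
Proof.
rewrite /dmul; case: eqP => [->|nab]; first by split=> [[->]|[_ ->]].
by split=> // -[].
Qed.

Definition discrete_groupoid : groupoid.
Proof.
refine (@Groupoid T setT id id dmul id _ _ _ _ _ _ _ _ _ _ _ _) => //=.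
- move=> a b; split=> [[c /dmulE[]]|->] //.
  by exists b; apply/dmulE.
- by move=> a b c /dmulE[-> ->].
- by move=> a b c /dmulE[-> ->].
- by move=> a b c ab bc /dmulE[-> ->] /dmulE[-> ->].
- by move=> a; apply/dmulE.
- by move=> a; apply/dmulE.
- by move=> a; apply/dmulE.
- by move=> a; apply/dmulE.
Defined.

Lemma discrete_mulE (a b c : discrete_groupoid) :
  gmul a b = Some c <-> a = b /\ c = a.
Proof. exact: dmulE. Qed.

Definition discrete_rel (G : groupoid) (f : G -> T) :
  set (G * discrete_groupoid) := [set p | gunit p.1 /\ p.2 = f p.1].

(** A groupoid of units only acts by fixing every point, so nothing restricts
    the base map [f]. *)
Lemma discrete_morphism (G : groupoid) (f : G -> T) :
  zakrzewski_morphism (discrete_rel f).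
Proof.
apply/zakrzewski_morphismP; rewrite /discrete_rel /=; split.
- move=> x a b; split.
    move=> [c /discrete_mulE[<- ->] [ux ax]]; exists x, x.
    by split=> //; exact: unit_mul.
  move=> [x1 [x2 [[u1 a1] [u2 b2] x12]]]; exists a.
    by apply/discrete_mulE; rewrite b2 -(composable_units u1 u2 x12) a1.
  by rewrite (units_mul u1 u2 x12).
- move=> x a; split=> -[ux ->]; first by rewrite inv_unit.
  by have := inv_unit ux; rewrite invK => xE; rewrite -xE in ux *.
- move=> x; split=> [[? _ []]|ux] //.
  by exists (f x).
Qed.

End Discrete.

(** The constant function and the characteristic function of the complement of
    the domain agree at every unit that [phi] relates to something. *)
Lemma mono_unit_dom (G D : groupoid) (phi : set (D * G)) :
  zakrzewski_mono phi -> @gunit G `<=` rel_dom phi.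
Proof.
move=> phi_mono e ue; apply: contrapT => eD.
pose f g := `[< ~ rel_dom phi g >].
have fF d g : phi (d, g) -> f g = false.
  by move=> pg; apply: asboolF; apply; exists d.
suff hk : discrete_rel (fun _ : G => false) = discrete_rel f.
  have : discrete_rel f (e, false) by rewrite -hk.
  by case=> _; rewrite /f (asboolT eD).
apply: phi_mono; [exact: discrete_morphism..|].
apply/predeqP=> -[d b]; rewrite /rel_comp /discrete_rel /=.
by split=> -[g pg [ug ->]]; exists g; rewrite ?(fF _ _ pg).
Qed.

(** * Monomorphisms have trivial kernel *)

Section WideSubgroupoid.
Variables (G : groupoid) (P : set G).
Hypothesis P_unit : @gunit G `<=` P.
Hypothesis P_mul : forall a b c, gmul a b = Some c -> P a -> P b -> P c.
Hypothesis P_inv : forall a, P a -> P (ginv a).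

Let T := {a : G | P a}.

Let T_eq (a b : T) : sval a = sval b -> a = b.
Proof. by case: a b => a Pa [b Pb] /= ab; exact: eq_exist. Qed.

(** Closure under multiplication enters only in [smul_ex]: the product is
    looked up in the subtype, so its defining equation [smulE] needs no proof
    that it lies in [P]. *)
Let smul (a b : T) : option T :=
  if pselect (exists c : T, gmul (sval a) (sval b) = Some (sval c)) is left ex
  then Some (sval (cid ex)) else None.

Let smulE a b c : smul a b = Some c <-> gmul (sval a) (sval b) = Some (sval c).
Proof.
rewrite /smul; case: pselect => [ex|nex].
  case: cid => c' /= ->; split=> [[->]|[/T_eq ->]] //.
by split=> // abc; case: nex; exists c.
Qed.

Let smul_ex a b c : gmul (sval a) (sval b) = Some c ->
  exists2 c', smul a b = Some c' & sval c' = c.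
Proof.
move=> abc; exists (exist _ c (P_mul abc (svalP a) (svalP b))) => //.
exact/smulE.
Qed.

Definition wide_subgroupoid : groupoid.
Proof.
refine (@Groupoid T [set a | gunit (sval a)]
  (fun a => exist _ (gsrc (sval a)) (P_unit (gsrc_unit (sval a))))
  (fun a => exist _ (gtgt (sval a)) (P_unit (gtgt_unit (sval a))))
  smul (fun a => exist _ (ginv (sval a)) (P_inv (svalP a)))
  _ _ _ _ _ _ _ _ _ _ _ _) => /=.
- by move=> a; exact: gsrc_unit.
- by move=> a; exact: gtgt_unit.
- by move=> e ue; apply: T_eq; exact: gunit_src.
- by move=> e ue; apply: T_eq; exact: gunit_tgt.
- move=> a b; split.
    by move=> [c /smulE/mul_composable ab]; exact: T_eq.
  by move=> [/gmul_def[c /smul_ex[c' abc' _]]]; exists c'.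
- by move=> a b c /smulE/gsrc_mul abc; exact: T_eq.
- by move=> a b c /smulE/gtgt_mul abc; exact: T_eq.
- move=> a b c ab bc /smulE mab /smulE mbc.
  have E x : smul ab c = Some x <-> smul a bc = Some x.
    by rewrite !smulE (gmulA mab mbc).
  case abc : (smul ab c) => [x|]; first by apply/esym/E.
  by case a_bc : (smul a bc) => [x|] //; move/E: a_bc; rewrite abc.
- by move=> a; apply/smulE; exact: gmul_src.
- by move=> a; apply/smulE; exact: gmul_tgt.
- by move=> a; apply/smulE; exact: gmul_invl.
- by move=> a; apply/smulE; exact: gmul_invr.
Defined.

Lemma wide_mulE (a b c : wide_subgroupoid) :
  gmul a b = Some c <-> gmul (sval a) (sval b) = Some (sval c).
Proof. exact: smulE. Qed.

Lemma wide_mul_ex (a b : wide_subgroupoid) c :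
  gmul (sval a) (sval b) = Some c ->
  exists2 c', gmul a b = Some c' & sval c' = c.
Proof. exact: smul_ex. Qed.

Definition wide_incl : set (G * wide_subgroupoid) :=
  rel_of_fun (fun a : wide_subgroupoid => sval a).

Definition wide_src : set (G * wide_subgroupoid) :=
  rel_of_fun (fun a : wide_subgroupoid => gsrc (sval a)).

Lemma wide_incl_morphism : zakrzewski_morphism wide_incl.
Proof.
apply/zakrzewski_morphismP; rewrite /wide_incl /rel_of_fun /=; split.
- move=> x a b; split.
    by move=> [c /wide_mulE abc ->]; exists (sval a), (sval b).
  move=> [_ [_ [-> -> /wide_mul_ex[c abc cx]]]].
  by exists c.
- move=> x a; split=> [->|<-]; rewrite invK //.
- move=> x; split=> [[e ue ->]|ux] //.
  by exists (exist _ x (P_unit ux)).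
Qed.

(** In a bundle of groups, composable arrows have the same source, so taking
    the source is compatible with multiplication. *)
Lemma wide_src_morphism : (forall a, P a -> gsrc a = gtgt a) ->
  zakrzewski_morphism wide_src.
Proof.
move=> P_iso; apply/zakrzewski_morphismP.
rewrite /wide_src /rel_of_fun /=; split.
- move=> x a b; split.
    move=> [c /wide_mulE abc ->]; exists (gsrc (sval a)), (gsrc (sval b)).
    have -> : gsrc (sval a) = gsrc (sval b).
      by rewrite (mul_composable abc) -P_iso //; exact: svalP b.
    by rewrite (gsrc_mul abc) unit_mul //; exact: gsrc_unit.
  move=> [_ [_ [-> -> xab]]].
  have sab := composable_units (gsrc_unit _) (gsrc_unit _) xab.
  have [c0] : exists c, gmul (sval a) (sval b) = Some c.
    by apply/gmul_def; rewrite sab P_iso //; exact: svalP b.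
  move=> /[dup] abc0 /wide_mul_ex[c abc cc0]; exists c => //.
  by rewrite cc0 (gsrc_mul abc0) -sab (units_mul _ _ xab) //; exact: gsrc_unit.
- move=> x a; rewrite src_inv -P_iso; last exact: svalP a.
  split=> [->|sx]; first by rewrite inv_unit //; exact: gsrc_unit.
  by rewrite -(invK x) sx inv_unit //; exact: gsrc_unit.
- move=> x; split=> [[e _ ->]|ux]; first exact: gsrc_unit.
  by exists (exist _ x (P_unit ux)) => //=; rewrite gunit_src.
Qed.

End WideSubgroupoid.

Arguments wide_incl {G P} P_unit P_mul P_inv.
Arguments wide_src {G P} P_unit P_mul P_inv.

Lemma ker_of_mono (G D : groupoid) (phi : set (D * G)) :
  zakrzewski_morphism phi -> zakrzewski_mono phi -> ker_rel phi = @gunit G.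
Proof.
move=> mphi phi_mono.
have unitK := unit_sub_ker mphi (mono_unit_dom phi_mono).
apply/seteqP; split=> // g0 Kg0.
have mulK := @ker_mul _ _ _ mphi; have invKer := @ker_inv _ _ _ mphi.
suff hk : wide_incl unitK mulK invKer = wide_src unitK mulK invKer.
  have : wide_src unitK mulK invKer (g0, exist _ g0 Kg0) by rewrite -hk.
  rewrite /wide_src /rel_of_fun /= => ->; exact: gsrc_unit.
apply: phi_mono; first exact: wide_incl_morphism.
  by apply: wide_src_morphism; exact: (ker_src_tgt mphi).
(* A lift of a kernel arrow is a unit, hence is its own source, which is also
   the lift of the source of the arrow. *)
apply/predeqP=> -[d [g Kg]].
rewrite /rel_comp /wide_incl /wide_src /rel_of_fun /=.
split=> -[_ /[swap] -> pg].
  have ud : gunit d by case: Kg => _; apply.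
  by exists (gsrc g) => //; rewrite -(gunit_src ud); exact: morph_src pg.
have [x px sx] := exists_lift mphi pg.
have ux : gunit x by case: Kg => _; apply.
by exists g => //; rewrite -sx gunit_src.
Qed.

Theorem proposition3p11 (Gamma Delta : groupoid) (phi : set (Delta * Gamma))
    (hphi : zakrzewski_morphism phi) :
  zakrzewski_mono phi <-> ker_rel phi = @gunit Gamma.
Proof. by split=> [/(ker_of_mono hphi)|/(mono_of_ker hphi)]. Qed.
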